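(* Let $A \subset \mathbb{R}^4$ be any set of diameter $1$ (with respect to the Euclidean distance). Then $A$ can be partitioned into $8$ parts, each of diameter less than $0.9999$.
   Context: The diameter of a set $A\subset\mathbb{R}^4$ is $\operatorname{diam} A=\sup\{\|x-y\|_2 : x,y\in A\}$. Parts are allowed to be empty (an empty part has diameter $0$). *)

(* Defs.v *)
From mathcomp Require Export all_boot all_order all_algebra.
From mathcomp Require Export all_classical all_reals ereal.

Set Implicit Arguments.
Unset Strict Implicit.
Unset Printing Implicit Defensive.

Import Order.TTheory GRing.Theory Num.Theory.

Local Open Scope classical_set_scope.
Local Open Scope ring_scope.

(* The norm `|x| that MathComp-Analysis puts on row vectors is the maximum
   norm, so the Euclidean norm is defined here. *)
Definition enorm (R : realType) (n : nat) (x : 'rV[R]_n) : R :=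
  Num.sqrt (\sum_(i < n) x ord0 i ^+ 2).

(* The supremum of the pairwise distances, taken in [0, +oo]: the maximum with 0
   only matters for A = set0, where ereal_sup is -oo and the diameter is 0.
   An unbounded set has diameter +oo. *)
Definition diam (R : realType) (n : nat) (A : set 'rV[R]_n) : \bar R :=
  Order.max 0%E
    (ereal_sup [set d : \bar R |
       exists x y, [/\ A x, A y & d = (enorm (x - y))%:E]]).

(* P is a partition of A into parts that may be empty; the library's
   [partition] would require every part to be nonempty. *)
Definition weak_partition (T I : Type) (P : I -> set T) (A : set T) : Prop :=
  trivIset setT P /\ cover setT P = A.

(* Main.v *)
Require Import Defs.
From mathcomp Require Import ring lra.

(* Let r be the circumradius of A, with centre at the origin. By minimality the points of A
   near the circumsphere nearly balance, and a trace inequality for their Gram matrix gives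
   two of them, p and d, with <p, d> <= - r^2 / 4 up to a small error; hence r^2 <= 2/5
   (Jung). Choose coordinates (f, m, w), w in the plane orthogonal to p and d, with p and d at
   (a, b, 0) and (- a, b, 0). Then A lies in the ball of radius r and in the unit balls about
   p and d. Cut off two caps 4/5 |f| + m >= h, one for each sign of f, and a bottom cap
   m < b - G, and divide the rest into five sectors according to the direction of w. For two
   points x, y of one sector, <w_x, w_y> >= 7/25 min(|w_x|^2, |w_y|^2), which turns the bound
   on |x - y|^2 into a quadratic problem in the (f, m)-plane. *)

Set Implicit Arguments.
Unset Strict Implicit.
Unset Printing Implicit Defensive.

Import Order.TTheory GRing.Theory Num.Theory.

Local Open Scope classical_set_scope.
Local Open Scope ring_scope.

(** * Distances inside a part *)

Lemma sqr_le (K : realFieldType) (x y : K) : 0 <= y -> x^+2 <= y^+2 -> x <= y.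
Proof.
move=> y0 xy; have [x0|/ltW x0] := leP 0 x; last exact: le_trans x0 y0.
by rewrite -(ler_pXn2r (_ : 0 < 2)%N).
Qed.

(** [kink_quartic1] and [kink_quartic2] are the squared forms of [e1] and [e2] in [kink_bound].
    Inside the range of [r] the quartics are almost 0, near 3/5 and near 1/2 respectively, and are
    expanded there. *)
Lemma kink_quartic1 (K : realFieldType) (r : K) : 1/2 - 1/10^+3 <= r -> r <= 19/30 ->
  0 <= (2*r^+2+43/32*r-1)^+2 - (131/64*r)^+2*(41/25*(r^+2-(1/4-1/10^+3))).
Proof.
move=> h1 h2.
pose s := r - 3/5.
have -> : r = s + 3/5 by rewrite /s; ring.
have s1 : -(51/500) <= s by rewrite /s; lra.
have s2 : s <= 1/30 by rewrite /s; lra.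
have := sqr_ge0 s; nra.
Qed.

Lemma kink_quartic2 (K : realFieldType) (r : K) : 1/2 - 1/10^+3 <= r -> r <= 19/30 ->
  0 <= (2*r^+2+21/20*r-1)^+2 - (16/25*r)^+2*(41/25*(r^+2-(1/4-1/10^+3))).
Proof.
move=> h1 h2.
pose s := r - 1/2.
have -> : r = s + 1/2 by rewrite /s; ring.
have s1 : -(1/10^+3) <= s by rewrite /s; lra.
have s2 : s <= 2/15 by rewrite /s; lra.
have := sqr_ge0 s; nra.
Qed.

(* [h <= ...] is checked at the two ends [a = r] and [a = 15/19 r] of the arc
   [a^2 + b^2 = r^2]; in between the arc lies above its chord. *)
Lemma kink_bound (K : realFieldType) (a b h r : K) :
  0 <= b -> 0 < a -> 0 < r -> r^+2 = a^+2+b^+2 -> 78/125 * r^+2 <= a^+2 ->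
  1/2 - 1/10^+3 <= r -> r <= 19/30 ->
  0 <= h -> h^+2 = 41/25*(r^+2-(1/4-1/10^+3)) ->
  h * (16/25*a+(2+64/125)*b) <= 21/20*a+21/25*b-1+2*r^+2.
Proof.
move=> b0 a0 r0 hr ha hr1 hr2 h0 hh.
have Har : 15/19*r <= a.
  by apply: sqr_le; [lra|have := sqr_ge0 r; rewrite exprMn; lra].
have Hbr : b <= 27/44*r.
  by apply: sqr_le; [lra|have := sqr_ge0 r; rewrite exprMn; lra].
have ar : a <= r by apply: sqr_le; [lra|have := sqr_ge0 b; lra].
have r2 : 249/10^+3 <= r^+2 by have := sqr_ge0 (r - (1/2 - 1/10^+3)); lra.
(* The end [a = 15/19*r], [b = 27/44*r], with 131/64 rounded up and 43/32 rounded down. *)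
have e1 : h * (131/64*r) <= 2*r^+2+43/32*r-1.
  apply: sqr_le; first by lra.
  have := kink_quartic1 hr1 hr2; rewrite [in X in _ -> X]exprMn hh; lra.
have e2 : h * (16/25*r) <= 2*r^+2+21/20*r-1.
  apply: sqr_le; first by lra.
  have := kink_quartic2 hr1 hr2; rewrite [in X in _ -> X]exprMn hh; lra.
have hle : h <= 1.
  apply: sqr_le => //; have : 0 <= (19/30 - r)*(19/30 + r) by apply: mulr_ge0; lra.
  lra.
clear hh hr1 hr2 ha.
have h1 : 0 <= h * (a - 15/19*r) by apply: mulr_ge0; lra.
have h2 : 0 <= h * (27/44*r - b) by apply: mulr_ge0; lra.
(* 105/314 is the zero of the coefficient of [b]. Above it the worst case is the largest [b] with
   the smallest [a], which is [e1]. *)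
have [hs|hs] := leP h (105/314); last first.
  have h8 : 0 <= (h - 105/314)*(27/44*r-b) by apply: mulr_ge0; lra.
  have h9 : 0 <= (1 - h)*(a - 15/19*r) by apply: mulr_ge0; lra.
  have h11 : 0 <= h * r by apply: mulr_ge0; lra.
  clear -e1 h8 h9 Har h11 r0; lra.
have chord : 67/23*(r-a) <= b.
  have e : (r-a)*(r+a) = b^+2 by rewrite -subr_sqr hr; ring.
  have [b1|b1] := ltP 0 b; last first.
    have b00 : b = 0 by lra.
    move: e; rewrite b00 expr0n /= => /eqP; rewrite mulf_eq0 => /orP[] /eqP; lra.
  rewrite -(ler_pM2r b1) -expr2 -e.
  have : 0 <= (r - a) * (r + a - 67/23 * b) by apply: mulr_ge0; lra.
  clear; lra.
have h6 : 0 <= r * ((21/25 - (2+64/125)*h) * (b - 67/23*(r-a))).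
  by do 2?apply: mulr_ge0; lra.
have h7 : 0 <= (r - a) * (2*r^+2+43/32*r-1 - h * (131/64*r)).
  by apply: mulr_ge0; lra.
have h8 : 0 <= (a-15/19*r) * (2*r^+2+21/20*r-1 - h * (16/25*r)).
  by apply: mulr_ge0; lra.
have h9 : 0 <= (r - a) * r by apply: mulr_ge0; lra.
have h10 : 0 <= h * ((r - a) * r) by apply: mulr_ge0.
have r01 : 0 < 4/19 * r by lra.
(* [4/19*r] is the width of the range of [a]: the factors [r - a] and [a - 15/19*r] interpolate
   between [e1] and [e2]. *)
rewrite -(ler_pM2r r01).
clear -h6 h7 h8 h9 h10; lra.
Qed.

(* In the frame of the header, the touching points are [(a, b, 0)] and [(- a, b, 0)].
   The top parts [4/5 |f| + m >= h] and the bottom part [m < b - G] are contained in caps of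
   balls of radius [sqrt (a^2 + b^2)] and [sqrt (1 - a^2)]; [h] and [G] are chosen so that
   these caps have squared diameter [996/1000]. *)
Definition admissible (K : realFieldType) (a b h G : K) : Prop :=
  [/\ [/\ 0 <= b, 0 < a & a <= 1/2],
      78/125 * (a^+2+b^+2) <= a^+2, 1/4 - 1/20/10^+2 <= a^+2+b^+2,
      0 <= h /\ h^+2 = 41/25*(a^+2+b^+2-(1/4-1/10^+3)) &
      0 <= G /\ G^+2 = 3/4+1/10^+3-a^+2].

(** Rational bounds, constant or affine in [b] or [a^2], that stand in for the square roots [h] and
    [G] in the estimates below. *)
Lemma admissible_bounds (K : realFieldType) (a b h G : K) : admissible a b h G ->
  [/\ 39/100 <= a, b <= 7/18, h <= b + 3/25, h <= 1/24 + 13/11 * b &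
   [/\ 7/10 <= G, G <= 17/24 * (5/4 - a^+2), G <= 31/40, a^+2+b^+2 <= 401/10^+3 & a^+2 <= 1/4] ].
Proof.
move=> [[b0 a0 a1] ha hR [h0 hh] [G0 hG]].
have a2 : a^+2 <= 1/4 by have : 0 <= (1/2 - a)*(1/2+a) by [apply: mulr_ge0; lra]; lra.
have bl : b <= 7/18 by apply: sqr_le; lra.
have b2 : 0 <= b * (7/18 - b) by apply: mulr_ge0; lra.
have al : 39/100 <= a by apply: sqr_le; lra.
split=> //.
- by apply: sqr_le; lra.
- by apply: sqr_le; lra.
split=> //.
- by apply: sqr_le; lra.
- apply: sqr_le; first by lra.
  have := sqr_ge0 (1/4 - a^+2); lra.
- by apply: sqr_le; lra.
- lra.
Qed.

(** For two points of one sector, [2*q] removes 14/25 of the part of [X] off the (f, m)-plane, which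
    leaves [11/25*X + 14/25*(f^2+m^2)]. The last term bounds [- 2*(m-b)*m'] for [m' >= b - G]. *)
Lemma cap_bound (K : realFieldType) (a b h G m : K) : admissible a b h G -> b <= m -> m <= h ->
  11/25*(a^+2+b^+2+1/40/10^+2) + 14/25*h^+2 + 1 - (a^+2+b^+2) + 2*((G-b)*(m-b)) <= 1 - 1/500.
Proof.
move=> adm bm mh.
have [al bl _ hb [G1 G2 G3 R1 a2]] := admissible_bounds adm.
case: adm => [[b0 a0 a1] ha hR [h0 ->] [G0 hG]].
have h1 : 0 <= (G-b)*(1/24+2/11*b-(m-b)) by apply: mulr_ge0; lra.
have h2 : 0 <= (17/24*(5/4-a^+2)-G)*(1/24+2/11*b) by apply: mulr_ge0; lra.
have h3 : 0 <= (1/4-a^+2)*(7/18-b) by apply: mulr_ge0; lra.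
have h4 : 0 <= (7/18-b)*b by apply: mulr_ge0; lra.
lra.
Qed.

(* [F] is the abscissa of the point where the sphere about the centre, the unit sphere
   about a touching point and the facet of a top part meet; the left-hand side plus
   [2 (a^2 + b^2)] is the squared distance from it to its mirror image. *)
Lemma kink_value (K : rcfType) (a b h G C F : K) : admissible a b h G ->
  C <= 1 - 2*(a^+2+b^+2) -> 0 <= C + 2*b*h -> 2*(a+4/5*b)*F = C + 2*b*h ->
  18/25*F^+2+16/5*h*F-2*h^+2 <= 1-1/500-1/20/10^+2-2*(a^+2+b^+2).
Proof.
move=> adm hC hC0 hF.
have [al bl _ hb [G1 G2 G3 R1 a2]] := admissible_bounds adm.
case: adm => [[b0 a0 a1] ha hR [h0 hh] [G0 hG]].
have R0 : 0 <= a^+2+b^+2 by lra.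
pose r := Num.sqrt (a^+2+b^+2).
have hr : r^+2 = a^+2+b^+2 by rewrite sqr_sqrtr.
have r1 : 1/2 - 1/10^+3 <= r by apply: sqr_le; [exact: sqrtr_ge0|lra].
have r2 : r <= 19/30 by apply: sqr_le; lra.
have r0 : 0 < r by lra.
have := @kink_bound _ a b h r b0 a0 r0 hr; rewrite hr => /(_ ha r1 r2 h0 hh) kb.
have q0 : 0 < a+4/5*b by lra.
(* Multiplied by [2*(a+4/5*b)], and with [C] at its upper bound, this is [kink_bound]. *)
have F1 : F <= 21/40 - 8/25*h by rewrite -(ler_pM2l q0); lra.
have F0 : 0 <= F by rewrite -(pmulr_rge0 _ q0); lra.
clear -F1 F0 h0 hh.
have h1 : 0 <= (21/40 - 8/25*h - F)*(21/40 - 8/25*h + F) by apply: mulr_ge0; lra.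
have h2 : 0 <= (21/40 - 8/25*h - F)*h by apply: mulr_ge0; lra.
have := sqr_ge0 (h - 2/5).
have -> : a^+2+b^+2 = 25/41*h^+2 + (1/4-1/10^+3) by rewrite hh; field.
have := sqr_ge0 (h - 5/12).
lra.
Qed.

(** The signs of multipliers in [kink_identity]: [w] splits one of them between the ball about the
    centre and a unit ball, and the third quantity belongs to the facet constraint on (f, m). *)
Lemma kink_weight (K : realFieldType) (a b h G C w : K) : admissible a b h G ->
  C = 1 - 2*(a^+2+b^+2) - 1/40/10^+2 ->
  2*(a+4/5*b)^+2*w = 9/25*C + 2*h*(b+4/5*a) ->
  [/\ 0 <= w, w <= 1 & 0 <= 2*b*w*(a+4/5*b) + (4/5*C-2*h*a)].
Proof.
move=> adm hC hw.
have [al bl hb _ [_ _ _ R1 a2]] := admissible_bounds adm.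
case: adm => [[b0 a0 a1] ha hR [h0 _] _].
have q0 : 0 < a+4/5*b by lra.
have q20 : 0 < 2*(a+4/5*b)^+2 by rewrite mulr_gt0 ?exprn_gt0.
have hbz : 0 <= h*(b+4/5*a) by apply: mulr_ge0; lra.
have h1 : 0 <= (b+3/25-h)*(b+4/5*a) by apply: mulr_ge0; lra.
split.
- by rewrite -(pmulr_rge0 _ q20) hw; lra.
- rewrite -(ler_pM2l q20) hw mulr1 hC.
  have h2 : 0 <= b*(a-39/100) by apply: mulr_ge0; lra.
  have h3 := sqr_ge0 (a-39/100).
  have [a3|a3] := leP (9/20) a.
    have h4 := sqr_ge0 (a-9/20).
    by clear - h1 h2 h3 h4 a3 b0; lra.
  have b3 : 1/5 <= b.
    apply: sqr_le => //; have : 0 <= (9/20-a)*(9/20+a) by apply: mulr_ge0; lra.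
    by clear - hR; lra.
  by clear - h1 h2 h3 b3 al; lra.
- rewrite -(pmulr_lge0 _ q0).
  have -> : (2*b*w*(a+4/5*b) + (4/5*C-2*h*a))*(a+4/5*b)
            = C*(b+4/5*a) - 2*h*(a^+2-b^+2).
    have -> : (2*b*w*(a+4/5*b) + (4/5*C-2*h*a))*(a+4/5*b)
            = b*(2*(a+4/5*b)^+2*w) + (4/5*C-2*h*a)*(a+4/5*b) by ring.
    by rewrite hw; field.
  have h4 : 0 <= (b+3/25-h)*(a^+2-b^+2) by apply: mulr_ge0; lra.
  have h2 : 0 <= (C + 1/40/10^+2 - 2*(a^+2-b^+2))*(b+4/5*a).
    by apply: mulr_ge0; rewrite ?hC; lra.
  have h3 : 0 <= (a^+2-b^+2-3/50)*(4/5*a-3/25) by apply: mulr_ge0; lra.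
  by clear - h4 h2 h3 a0 bl a1 al; lra.
Qed.

(** The first summand carries the slack of [kink_value]; every other one is a multiplier times the
    slack of a constraint in [kink_side]. *)
Lemma kink_identity (K : realFieldType) (R a b f m X f' m' Y h C F w : K) :
  C = 1 - 2*R - 1/40/10^+2 ->
  2*(a+4/5*b)^+2*w = 9/25*C + 2*h*(b+4/5*a) ->
  2*(a+4/5*b)*F = C + 2*b*h ->
  (a+4/5*b) * (1 - 1/500 - (X + Y + 2*f*f' - 2 * m* m')) =
  (a+4/5*b) * (1-1/500-1/20/10^+2-2*R - (18/25*F^+2+16/5*h*F-2*h^+2))
  + (a+4/5*b - (f+4/5 * m)) * (R+1/40/10^+2 - Y)
  + (f+4/5 * m) * (1 - R - (Y + 2*a*f' - 2*b * m'))
  + 2*((b*f-a * m) * (h - (4/5*f' + m')))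
  + (a+4/5*b) * ((1-w) * (R+1/40/10^+2 - X))
  + (a+4/5*b) * (w * (1 - R - (X + 2*a*f - 2*b * m)))
  + (2*b*w*(a+4/5*b) + (4/5*C-2*h*a)) * (h - (4/5*f + m)).
Proof.
move=> hC /eqP; rewrite -subr_eq0 => /eqP hw /eqP; rewrite -subr_eq0 => /eqP hF.
apply/eqP; rewrite -subr_eq0; apply/eqP.
(* The two sides differ by a combination of the defining equations of [F] and [w], with these
   cofactors. *)
transitivity ((2*(a+4/5*b)*F - (C + 2*b*h)) * ((a+4/5*b)*w + 9/25*F + 4/5*h)
  - (2*(a+4/5*b)^+2*w - (9/25*C + 2*h*(b+4/5*a))) * (F - f)).
  by rewrite hC; clear; field.
by rewrite hF hw !mul0r subr0.
Qed.

(* Points on opposite sides of [f = 0]: linear programming duality, with the multipliers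
   displayed in [kink_identity]. *)
Lemma kink_side (K : rcfType) (a b h G f m X f' m' Y : K) : admissible a b h G ->
  f^+2 + m^+2 <= X -> X <= a^+2+b^+2+1/40/10^+2 -> X + 2*a*f - 2*b * m <= 1 - (a^+2+b^+2) ->
  4/5*f + m <= h ->
  Y <= a^+2+b^+2+1/40/10^+2 -> Y + 2*a*f' - 2*b * m' <= 1 - (a^+2+b^+2) ->
  4/5*f' + m' <= h ->
  a * m <= b*f -> 0 <= f + 4/5 * m ->
  X + Y + 2*f*f' - 2 * m* m' <= 1 - 1/500.
Proof.
move=> adm hX Q P T Q' P' T' hD hL.
have [al bl hb _ [_ _ _ R1 a2]] := admissible_bounds adm.
have kv := @kink_value _ a b h G _ _ adm.
have kw := @kink_weight _ a b h G _ _ adm.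
case: adm => [[b0 a0 a1] _ _ [h0 _] _].
have q0 : 0 < a+4/5*b by lra.
pose C := 1 - 2*(a^+2+b^+2) - 1/40/10^+2.
have f1 : f <= 16/25 by apply: sqr_le; [lra|have := sqr_ge0 m; lra].
have hq : 0 <= a+4/5*b - (f+4/5 * m) by clear - f1 T hb al; lra.
have bh : 0 <= b*h by apply: mulr_ge0.
have C0 : 0 <= C by rewrite /C; clear - R1; lra.
have q1 : a+4/5*b != 0 by rewrite gt_eqF.
have [F hF] : exists F, 2*(a+4/5*b)*F = C + 2*b*h.
  exists ((C + 2*b*h)/(2*(a+4/5*b))).
  by rewrite mulrC divfK // mulf_neq0 ?pnatr_eq0.
have [w hw] : exists w, 2*(a+4/5*b)^+2*w = 9/25*C + 2*h*(b+4/5*a).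
  exists ((9/25*C + 2*h*(b+4/5*a))/(2*(a+4/5*b)^+2)).
  by rewrite mulrC divfK // !mulf_neq0 ?pnatr_eq0.
have {kw} [//|w0 w1 nu0] := kw C w _ hw.
have {}kv := kv C F.
rewrite -subr_ge0 -(pmulr_rge0 _ q0).
rewrite (kink_identity _ _ _ _ _ _ (erefl C) hw hF).
have ltF : 0 <= 1 - 1/500 - 1/20/10^+2 - 2*(a^+2+b^+2) - (18/25*F^+2+16/5*h*F-2*h^+2).
  by rewrite subr_ge0; apply: kv => //; rewrite /C; clear - bh C0 R1; lra.
have q00 := ltW q0.
by rewrite !addr_ge0 ?mulr_ge0 ?subr_ge0 // -subr_ge0.
Qed.

Lemma upper_case (K : realFieldType) (a b h G f m X f' m' Y q : K) : admissible a b h G ->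
  0 <= f -> 0 <= m ->
  f^+2 + m^+2 <= X -> X <= a^+2+b^+2+1/40/10^+2 -> X + 2*a*f - 2*b * m <= 1 - (a^+2+b^+2) ->
  4/5*f + m <= h -> f'^+2 + m'^+2 <= Y ->
  Y <= a^+2+b^+2+1/40/10^+2 -> Y + 2*a*`|f'| - 2*b * m' <= 1 - (a^+2+b^+2) ->
  b - G <= m' -> 0 <= f' \/ b*f <= a * m ->
  7/25 * (X - f^+2 - m^+2) <= q ->
  X + Y - 2*f*f' - 2 * m* m' - 2*q <= 1 - 1/500.
Proof.
move=> adm f0 m0 hX Q P T hY Q' P' K' side hq.
have [al bl hb hb' [G1 _ G3 R1 a2]] := admissible_bounds adm.
have cb := @cap_bound _ a b h G m adm.
case: adm => [[b0 a0 a1] _ _ [h0 hh] _].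
have nf0 := normr_ge0 f'.
have nf : - `|f'| <= f' by rewrite lerNl -normrN ler_norm.
(* From the slope 9/40 on, [(4/5*f+m)^2 >= f^2+m^2], so the facet gives [f^2+m^2 <= h^2]. *)
have [mf|mf] := leP (9/40*f) m.
  have Nh : f^+2 + m^+2 <= h^+2.
    have h1 : 0 <= (h - (4/5*f + m))*(h + (4/5*f+m)) by clear - f0 m0 h0 T; apply: mulr_ge0; lra.
    have h2 : 0 <= f * (m - 9/40*f) by clear - f0 mf; apply: mulr_ge0; lra.
    by clear - h1 h2; lra.
  have [mb|mb] := leP m b; last first.
    have h1 : 0 <= (m-b)*(m'-(b-G)) by clear - mb K'; apply: mulr_ge0; lra.
    have h2 : 0 <= (a-f) * `|f'| by clear - al hb mb T nf0; apply: mulr_ge0; lra.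
    have h3 : 0 <= f * (f' + `|f'|) by clear - f0 nf; apply: mulr_ge0; lra.
    have {}cb := cb (ltW mb) ltac:(clear - f0 T; lra).
    by clear - h1 h2 h3 hq Q P' Nh cb; lra.
  (* The mean of the unit-ball bound and the centre-ball bound on [Y], with weights [m/b] and
     [1 - m/b]. *)
  have psi : Y - 2*f*f' - 2 * m* m' <= 1 - (a^+2+b^+2).
    have [bp|bp] := ltP 0 b; last first.
      have -> : m = 0 by clear - mb m0 bp; lra.
      have -> : f = 0 by clear - mf mb f0 bp; lra.
      by clear - Q' R1; lra.
    have h1 : 0 <= m * (1 - (a^+2+b^+2) - (Y + 2*a*`|f'| - 2*b * m')) by rewrite mulr_ge0 ?subr_ge0.
    have h2 : 0 <= (b-m) * (a^+2+b^+2+1/40/10^+2 - Y) by rewrite mulr_ge0 ?subr_ge0.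
    have h4 : 0 <= (b-m) * (1 - 2*(a^+2+b^+2) - 1/40/10^+2) by clear - mb R1; apply: mulr_ge0; lra.
    have h3 : - (b*f*f') <= a * m*`|f'|.
      case: side => [f'0|hs].
        apply: (@le_trans _ _ 0); last by rewrite !mulr_ge0 // ltW.
        by rewrite oppr_le0 !mulr_ge0.
      have h5 : 0 <= (a * m - b*f) * `|f'| by rewrite mulr_ge0 ?subr_ge0.
      have h6 : 0 <= b*f * (f' + `|f'|) by rewrite !mulr_ge0 //; clear - nf; lra.
      by clear - h5 h6; lra.
    rewrite -(ler_pM2l bp).
    by clear - h1 h2 h3 h4; lra.
  by clear - psi Nh hq Q hh R1; lra.
case: side => [f'0|hs].
  have h1 : 0 <= f*f' by rewrite mulr_ge0.
  have h2 : 0 <= m * (m'-(b-G)) by clear - m0 K'; apply: mulr_ge0; lra.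
  have h3 : 0 <= m * (31/40-G) by clear - m0 G3; apply: mulr_ge0; lra.
  have h4 : 0 <= f * (a-39/100) by clear - f0 al; apply: mulr_ge0; lra.
  have h5 : 0 <= m * b by rewrite mulr_ge0.
  have [f1|f1] := leP (1/100) f.
    by clear - h1 h2 h3 h4 f1 mf P Q' hq hX; lra.
  by clear - h1 h2 h3 h5 f1 mf m0 Q Q' hq hX R1; lra.
(* Since [b] is small against [a], so are [h] and [f]; the squares below then absorb [- 2*f*f'] and
   [- 2*m*m']. *)
have bs : b <= 9/40*a.
  have fp : 0 < f by clear - m0 mf; lra.
  rewrite -(ler_pM2r fp).
  have : 0 <= a * (9/40*f - m) by clear - a0 mf; apply: mulr_ge0; lra.
  by clear - hs; lra.
have h1 : 0 <= (11/50-f)*(11/50+f) by clear - f0 T m0 hb' bs a1; apply: mulr_ge0; lra.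
have h2 : 0 <= (9/40*f - m)*(9/40*f+m) by clear - f0 m0 mf; apply: mulr_ge0; lra.
have h3 : 0 <= (9/40*a - b)*(9/40*a+b) by clear - b0 a0 bs; apply: mulr_ge0; lra.
have := sqr_ge0 (2*f+f'/2); have := sqr_ge0 (2 * m+m'/2).
by clear - h1 h2 h3 hY Q Q' a2 hq hX; lra.
Qed.

(** On [[b - G, 0]] the square [m^2] lies below its chord, so the bound becomes affine in [m] and is
    checked at both ends. At [m = b - G], if [b <= h], it reduces to [cap_bound] at height [h]. *)
Lemma lower_case (K : realFieldType) (a b h G f m X f' m' Y q : K) : admissible a b h G ->
  0 <= f -> m <= 0 ->
  f^+2 + m^+2 <= X -> X + 2*a*f - 2*b * m <= 1 - (a^+2+b^+2) ->
  b - G <= m -> Y <= a^+2+b^+2+1/40/10^+2 -> 4/5*`|f'| + m' <= h ->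
  0 <= f' \/ f + 4/5 * m <= 0 ->
  7/25 * (X - f^+2 - m^+2) <= q ->
  X + Y - 2*f*f' - 2 * m* m' - 2*q <= 1 - 1/500.
Proof.
move=> adm f0 m0 hX P K1 Q' T' side hq.
have [al bl hb hb' [G1 _ G3 R1 a2]] := admissible_bounds adm.
have cb := @cap_bound _ a b h G h adm.
case: adm => [[b0 a0 a1] _ hR [h0 hh] [G0 hG]].
have nf0 := normr_ge0 f'.
have nf : - `|f'| <= f' by rewrite lerNl -normrN ler_norm.
have psi : - 2*f*f' - 2 * m* m' <= - 2 * m*h.
  have h1 : 0 <= - m * (h - (4/5*`|f'| + m')) by clear - m0 T'; apply: mulr_ge0; lra.
  case: side => [f'0|hs].
    have h2 : 0 <= f*f' by rewrite mulr_ge0.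
    have h3 : 0 <= - m * `|f'| by rewrite mulr_ge0 // oppr_ge0.
    by clear - h1 h2 h3; lra.
  have h2 : 0 <= f * (f' + `|f'|) by clear - f0 nf; apply: mulr_ge0; lra.
  have h3 : 0 <= (- (f+4/5 * m)) * `|f'| by rewrite mulr_ge0 // oppr_ge0.
  by clear - h1 h2 h3; lra.
have fa : f <= 1 - a.
  have : f + a <= 1.
    apply: sqr_le => //.
    have := sqr_ge0 (b - m).
    by clear - P hX; lra.
  by clear; lra.
(* 11/7 bounds [14/25*f^2] by [22/25*a*f], which cancels against 11/25 of [P]. *)
have h1 : 0 <= f * (11/7*a - f) by clear - f0 fa al; apply: mulr_ge0; lra.
have h2 : 0 <= - m * (m - (b-G)) by clear - m0 K1; apply: mulr_ge0; lra.
have [c0|c0] := leP 0 (14/25*G+2*h-36/25*b); last first.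
  have h3 : 0 <= - m * - (14/25*G+2*h-36/25*b) by clear - m0 c0; apply: mulr_ge0; lra.
  by clear - h1 h2 h3 psi P Q' hq R1; lra.
have h3 : 0 <= (m - (b-G)) * (14/25*G+2*h-36/25*b) by clear - K1 c0; apply: mulr_ge0; lra.
have [bh|bh] := leP b h.
  by have := cb bh (lexx h); clear - h1 h2 h3 psi P Q' hq hG hh hR; lra.
have h4 : 0 <= (G-b) * (b-h) by clear - G1 bl bh; apply: mulr_ge0; lra.
by clear - h1 h2 h3 h4 psi P Q' hq hG hR; lra.
Qed.

(** * Pairs of points in one sector *)

Definition in_rest (K : realFieldType) (a b h G f m w : K) : Prop :=
  [/\ 0 <= w, f^+2 + m^+2 + w <= a^+2+b^+2+1/40/10^+2,
      f^+2 + m^+2 + w + 2*a*`|f| - 2*b * m <= 1 - (a^+2+b^+2),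
      4/5*`|f| + m <= h & b - G <= m].

(* [q] is the inner product of the two components orthogonal to the plane of the touching
   points, [w] and [w'] are their squared lengths. *)
Lemma sector_pair_pos (K : rcfType) (a b h G f m w f' m' w' q : K) : admissible a b h G ->
  in_rest a b h G f m w -> in_rest a b h G f' m' w' -> 0 <= f -> 7/25 * w <= q ->
  (f^+2 + m^+2 + w) + (f'^+2 + m'^+2 + w') - 2*f*f' - 2 * m* m' - 2*q <= 1 - 1/500.
Proof.
move=> adm [w0 Q P T K1] [w'0 Q' P' T' K1'] f0 hq; rewrite ger0_norm // in P T.
have hX : f^+2 + m^+2 <= f^+2 + m^+2 + w by rewrite lerDl.
have hY : f'^+2 + m'^+2 <= f'^+2 + m'^+2 + w' by rewrite lerDl.
have hq' : 7/25 * (f^+2 + m^+2 + w - f^+2 - m^+2) <= q.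
  by rewrite (_ : _ - _ - _ = w) ?hq //; clear; ring.
have [[b0 a0 _] _ _ _ _] := adm.
have q0 : 0 <= q by clear - w0 hq; lra.
have kink : f' <= 0 -> a * m <= b*f -> 0 <= f + 4/5 * m ->
    (f^+2 + m^+2 + w) + (f'^+2 + m'^+2 + w') - 2*f*f' - 2 * m* m' - 2*q <= 1 - 1/500.
  move=> f'0 hD hL; rewrite ler0_norm // in P' T'.
  have := kink_side adm hX Q P T Q' P' T' hD hL.
  by clear - q0; lra.
have [m0|/ltW m0] := leP 0 m.
  have [f'0|/ltW f'0] := leP 0 f'; first by apply: (upper_case adm) => //; left.
  have [hD|/ltW hD] := leP (b*f) (a * m); first by apply: (upper_case adm) => //; right.
  by apply: kink => //; clear - f0 m0; lra.
have [f'0|/ltW f'0] := leP 0 f'; first by apply: (lower_case adm) => //; left.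
have [hL|/ltW hL] := leP (f + 4/5 * m) 0; first by apply: (lower_case adm) => //; right.
apply: kink => //; apply: (@le_trans _ _ 0); last by rewrite mulr_ge0.
by rewrite mulr_ge0_le0 // ltW.
Qed.

Lemma sector_pair (K : rcfType) (a b h G f m w f' m' w' q : K) : admissible a b h G ->
  in_rest a b h G f m w -> in_rest a b h G f' m' w' ->
  (w <= w' -> 7/25 * w <= q) -> (w' <= w -> 7/25 * w' <= q) ->
  (f^+2 + m^+2 + w) + (f'^+2 + m'^+2 + w') - 2*f*f' - 2 * m* m' - 2*q <= 1 - 1/500.
Proof.
move=> adm; wlog ww : f m w f' m' w' / w <= w' => [hw|] Hx Hy q1 q2.
  have [ww|/ltW ww] := leP w w'; first exact: hw.
  have := hw _ _ _ _ _ _ ww Hy Hx q2 q1; congr (_ <= _); ring.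
have {q1 q2}hq := q1 ww.
have [f0|/ltW f0] := leP 0 f; first exact: (sector_pair_pos adm Hx Hy f0 hq).
have flip (u v z : K) : in_rest a b h G u v z -> in_rest a b h G (-u) v z.
  by case=> *; split; rewrite ?normrN ?sqrrN.
have f1 : 0 <= - f by rewrite oppr_ge0.
have := sector_pair_pos adm (flip _ _ _ Hx) (flip _ _ _ Hy) f1 hq.
by congr (_ <= _); ring.
Qed.

(* The sectors are bounded by the rays through (1,0), (1,3), (-4,3), (-4,-3), (1,-3);
   consecutive rays make an angle of cosine at least 7/25. *)
Definition sector (K : realFieldType) (u v : K) : nat :=
  if 0 <= v then (if v <= 3*u then 0%N else if 0 <= 3*u+4*v then 1%N else 2%N)
  else if -v <= 3*u then 3%N else if 0 <= 3*u-4*v then 4%N else 2%N.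

(** The two expressions are proportional to the cosine and the sine of the angle between the
    vectors; 24/7 is the tangent of the angle with cosine 7/25. *)
Lemma sector_cone (K : realFieldType) (u v u' v' : K) : sector u v = sector u' v' ->
  - 24*(u*u'+v*v') <= 7*(u*v'-v*u') <= 24*(u*u'+v*v').
Proof.
rewrite /sector.
do ![case: leP => ?]; move=> // _; apply/andP; split; nra.
Qed.

(** By Lagrange's identity [q^2+c^2] is the product of the squared lengths, and the cone condition
    gives [q^2+c^2 <= (25/7*q)^2]. *)
Lemma same_sector_dot (K : realFieldType) (u v u' v' : K) : sector u v = sector u' v' ->
  u^+2+v^+2 <= u'^+2+v'^+2 -> 7/25*(u^+2+v^+2) <= u*u'+v*v'.
Proof.
move=> /sector_cone/andP[h1 h2] hle.
set q := u*u'+v*v' in h1 h2 *; set c := u*v'-v*u' in h1 h2.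
have q0 : 0 <= q by lra.
have s0 : 0 <= u^+2+v^+2 by rewrite addr_ge0 ?sqr_ge0.
have : 0 <= (24*q-7*c)*(24*q+7*c) by rewrite mulr_ge0 // -?lerBlDr ?subr_ge0; lra.
have e : q^+2+c^+2 = (u^+2+v^+2)*(u'^+2+v'^+2) by rewrite /q /c; ring.
have : 0 <= (u^+2+v^+2)*((u'^+2+v'^+2)-(u^+2+v^+2)) by rewrite mulr_ge0 ?subr_ge0.
move=> h3 h4; apply: sqr_le => //.
move: e h3 h4; clear; lra.
Qed.

(** * The eight parts *)

Definition part (K : realFieldType) (b h G f m u v : K) : nat :=
  if h <= 4/5*`|f| + m then (if 0 <= f then 0%N else 1%N)
  else if m < b - G then 2%N else (3 + sector u v)%N.

Lemma part_lt8 (K : realFieldType) (b h G f m u v : K) : (part b h G f m u v < 8)%N.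
Proof. by rewrite /part /sector; do !case: ifP. Qed.

(** The absolute value joins the unit balls about the two touching points; [1/40/10^+2] absorbs the
    error of an only nearly minimal radius. *)
Definition in_body (K : realFieldType) (a b f m w : K) : Prop :=
  f^+2 + m^+2 + w <= a^+2+b^+2+1/40/10^+2 /\
  f^+2 + m^+2 + w + 2*a*`|f| - 2*b * m <= 1 - (a^+2+b^+2).

(** Parallelogram law: the facet normal (4/5, 1) has squared length 41/25, so the sum of the two
    points has squared length at least [25/41*(2*h)^2]. *)
Lemma top_pair (K : realFieldType) (a b h G f m u v f' m' u' v' : K) : admissible a b h G ->
  in_body a b f m (u^+2+v^+2) -> in_body a b f' m' (u'^+2+v'^+2) ->
  h <= 4/5*f + m -> h <= 4/5*f' + m' ->
  (f-f')^+2+(m-m')^+2+(u-u')^+2+(v-v')^+2 <= 1 - 1/500.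
Proof.
move=> [_ _ _ [h0 hh] _] [Q _] [Q' _] T T'.
have h1 : 0 <= (4/5*f + m + (4/5*f' + m') - 2*h) * (4/5*f + m + (4/5*f' + m') + 2*h).
  by clear - h0 T T'; apply: mulr_ge0; lra.
have h2 := sqr_ge0 (4/5*(m+m') - (f+f')).
have h3 := sqr_ge0 (u+u'); have h4 := sqr_ge0 (v+v').
clear T T'; lra.
Qed.

(** The parallelogram law about (0, b, 0): both points lie within squared distance [1 - a^2] of it,
    and their sum relative to it has length at least [2*G]. *)
Lemma bottom_pair (K : realFieldType) (a b h G f m u v f' m' u' v' : K) : admissible a b h G ->
  in_body a b f m (u^+2+v^+2) -> in_body a b f' m' (u'^+2+v'^+2) ->
  m <= b - G -> m' <= b - G ->
  (f-f')^+2+(m-m')^+2+(u-u')^+2+(v-v')^+2 <= 1 - 1/500.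
Proof.
move=> [[_ a0 _] _ _ _ [G0 hG]] [_ P] [_ P'] T T'.
have h1 : 0 <= (2*b-m-m' - 2*G) * (2*b-m-m' + 2*G).
  by clear - G0 T T'; apply: mulr_ge0; lra.
have h2 := sqr_ge0 (f+f').
have h3 := sqr_ge0 (u+u'); have h4 := sqr_ge0 (v+v').
have h5 : 0 <= a*`|f| by rewrite mulr_ge0 // ltW.
have h6 : 0 <= a*`|f'| by rewrite mulr_ge0 // ltW.
clear T T'; lra.
Qed.

Lemma part_pair (K : rcfType) (a b h G f m u v f' m' u' v' : K) : admissible a b h G ->
  in_body a b f m (u^+2+v^+2) -> in_body a b f' m' (u'^+2+v'^+2) ->
  part b h G f m u v = part b h G f' m' u' v' ->
  (f-f')^+2+(m-m')^+2+(u-u')^+2+(v-v')^+2 <= 1 - 1/500.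
Proof.
move=> adm B B'.
have flip (x y z : K) : in_body a b x y z -> in_body a b (-x) y z.
  by rewrite /in_body normrN sqrrN.
rewrite /part; case: (leP h) => [T|/ltW T]; case: (leP h) => [T'|/ltW T']; last first.
- case: (ltP m) => [/ltW m0|m0]; case: (ltP m') => [/ltW m0'|m0'] //.
    by move=> _; apply: (bottom_pair adm B B').
  move=> /addnI sec.
  case: B B' => Q P [Q' P'].
  have w0 : 0 <= u^+2+v^+2 by rewrite addr_ge0 ?sqr_ge0.
  have w0' : 0 <= u'^+2+v'^+2 by rewrite addr_ge0 ?sqr_ge0.
  have Rx : in_rest a b h G f m (u^+2+v^+2) by [].
  have Ry : in_rest a b h G f' m' (u'^+2+v'^+2) by [].
  have sec' := same_sector_dot (esym sec); rewrite (mulrC u') (mulrC v') in sec'.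
  have := sector_pair adm Rx Ry (same_sector_dot sec) sec'.
  by congr (_ <= _); ring.
- by do 2?case: ifP.
- by do 2?case: ifP.
case: leP => [f0|/ltW f0]; case: leP => [f0'|/ltW f0'] // _.
  rewrite ger0_norm // in T; rewrite ger0_norm // in T'.
  exact: (top_pair adm B B').
rewrite ler0_norm // in T; rewrite ler0_norm // in T'.
have := top_pair adm (flip _ _ _ B) (flip _ _ _ B') T T'.
by congr (_ <= _); ring.
Qed.

(** * Circumcentre and touching points *)

Definition dot (R : realFieldType) (n : nat) (x y : 'rV[R]_n) : R := \sum_(i < n) x ord0 i * y ord0 i.

Lemma dotC (R : realFieldType) n (x y : 'rV[R]_n) : dot x y = dot y x.
Proof. by apply: eq_bigr => i _; rewrite mulrC. Qed.

Lemma dotDl (R : realFieldType) n (x y z : 'rV[R]_n) : dot (x + y) z = dot x z + dot y z.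
Proof. by rewrite -big_split /=; apply: eq_bigr => i _; rewrite mxE mulrDl. Qed.

Lemma dotZl (R : realFieldType) n a (x z : 'rV[R]_n) : dot (a *: x) z = a * dot x z.
Proof. by rewrite mulr_sumr; apply: eq_bigr => i _; rewrite mxE mulrA. Qed.

Lemma dotNl (R : realFieldType) n (x z : 'rV[R]_n) : dot (- x) z = - dot x z.
Proof. by rewrite -scaleN1r dotZl mulN1r. Qed.

Lemma dotDr (R : realFieldType) n (x y z : 'rV[R]_n) : dot z (x + y) = dot z x + dot z y.
Proof. by rewrite !(dotC z) dotDl. Qed.

Lemma dotZr (R : realFieldType) n a (x z : 'rV[R]_n) : dot z (a *: x) = a * dot z x.
Proof. by rewrite !(dotC z) dotZl. Qed.

Lemma dotNr (R : realFieldType) n (x z : 'rV[R]_n) : dot z (- x) = - dot z x.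
Proof. by rewrite !(dotC z) dotNl. Qed.

Definition dotE := (dotDl, dotDr, dotNl, dotNr, dotZl, dotZr).

Lemma dot_ge0 (R : realFieldType) n (x : 'rV[R]_n) : 0 <= dot x x.
Proof. by apply: sumr_ge0 => i _; rewrite -expr2 sqr_ge0. Qed.

Lemma dot_eq0 (R : realFieldType) n (x : 'rV[R]_n) : dot x x = 0 -> x = 0.
Proof.
move=> /eqP; rewrite psumr_eq0 => [/allP x0|i _]; last by rewrite -expr2 sqr_ge0.
apply/rowP => i; rewrite mxE; have := x0 i (mem_index_enum _).
by rewrite mulf_eq0 orbb => /eqP.
Qed.

Lemma ler_dot (R : realFieldType) n (x y : 'rV[R]_n) : 2 * dot x y <= dot x x + dot y y.
Proof.
have := dot_ge0 (x - y); rewrite !dotE (dotC y x); lra.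
Qed.

(* If every far point had [dot (a-c) v > e], a small shift of [c] along [v] would
   decrease the radius. *)
Lemma nearly_minimal_center (R : realType) n (A : set 'rV[R]_n) (e V : R) :
  A !=set0 -> (forall x y, A x -> A y -> dot (x-y) (x-y) <= 1) -> 0 < e -> e <= 1 -> 0 <= V ->
  exists c S, [/\ S <= 2, forall x, A x -> dot (x-c) (x-c) <= S &
    forall v, dot v v <= V -> exists2 a, A a & S - e <= dot (a-c) (a-c) /\ dot (a-c) v <= e].
Proof.
move=> [a0 Aa0] A1 e0 e1 V0.
pose U := [set s : R | exists c, forall x, A x -> dot (x-c) (x-c) <= s].
have U1 : U 1 by exists a0 => x Ax; exact: A1.
have Ulb : has_lbound U.
  by exists 0 => s [c hc]; apply: le_trans (hc _ Aa0); exact: dot_ge0.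
pose t := e / (4 * (1 + V)).
(* The step [t] is so short that the quadratic term of the shift costs at most [t*e/4], while far
   points gain [2*t*e]. The net drop [t*e] beats the gap [t*e/2] between [s] and the infimum. *)
have V1 : 0 < 4 * (1 + V) by lra.
have t0 : 0 < t by rewrite divr_gt0.
have tV : t * (4 * (1 + V)) = e by rewrite divfK // gt_eqF.
have tV0 : 0 <= t * V by rewrite mulr_ge0 // ltW.
have t1 : t <= 1/4 by lra.
have te0 : 0 < t * e by rewrite mulr_gt0.
have te1 : t * e <= e / 4.
  have : 0 <= (1/4 - t) * e by rewrite mulr_ge0 //; lra.
  lra.
have [s [c hc] sI] : exists2 s, U s & s < inf U + t * e / 2.
  by apply: inf_adherent; [rewrite divr_gt0|split => //; exists 1].
have I1 : inf U <= 1 by apply: ge_inf.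
exists c, s; split=> //; first by lra.
move=> v vV; apply: contrapT => hno.
have hyp a : A a -> dot (a-c) (a-c) < s - e \/ e < dot (a-c) v.
  move=> Aa; case: (ltP (dot (a-c) (a-c)) (s-e)) => [|h1]; first by left.
  case: (ltP e (dot (a-c) v)) => [|h2]; first by right.
  by case: hno; exists a.
have : inf U <= s - t * e.
  apply: ge_inf => //; exists (c + t *: v) => x Ax.
  have -> : x - (c + t *: v) = (x - c) - t *: v by rewrite opprD addrA.
  have := hc x Ax; have := hyp x Ax; have := ler_dot (x-c) (- v).
  rewrite (dotDl (x - c)) (dotDr (x-c)) (dotDr (x - c)) !(dotNl (t *: v), dotNr (t *: v), dotNr v, dotNl v, dotZl, dotZr) (dotC v (x-c)).
  set z := dot (x-c) (x-c); set y := dot (x-c) v; set q := dot v v in vV *.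
  have q0 : 0 <= q by exact: dot_ge0.
  have tq : 0 <= t * (V - q) by rewrite mulr_ge0 ?subr_ge0 // ltW.
  have ttq : t * (t * q) <= t * V / 4.
    have : 0 <= (1/4 - t) * (t * q) by apply: mulr_ge0; [lra|rewrite mulr_ge0 // ltW].
    lra.
  have ttq' : t * (t * q) <= t * e / 4.
    have : 0 <= t * (t * (V - q)) by rewrite mulr_ge0 // ltW.
    have : t * (t * (4 * (1+V))) = t * e by rewrite tV.
    have : 0 <= t * t by rewrite mulr_ge0 ?ltW.
    lra.
  move=> hl [hz|hy] hs.
    have : 0 <= t * (z + q + 2 * y) by apply: mulr_ge0; lra.
    have : 0 <= t * (2 - z) by apply: mulr_ge0; lra.
    lra.
  have : 0 <= t * (y - e) by apply: mulr_ge0; lra.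
  lra.
lra.
Qed.

(** Greedy choice: each new vector has inner product at most [e] with the sum so far, so the squared
    length of the sum grows by at most [S + 2*e]. This replaces a convex combination of touching
    points, which may not exist because the set need not be closed. *)
Lemma balanced_sequence (R : realType) n (Z : set 'rV[R]_n) (S e : R) (N : nat) :
  0 <= S -> 0 <= e -> (forall z, Z z -> dot z z <= S) ->
  (forall v, dot v v <= N%:R * (S + 2 * e) ->
     exists2 z, Z z & S - e <= dot z z /\ dot z v <= e) ->
  exists s : seq 'rV[R]_n, [/\ size s = N, forall z, z \in s -> Z z /\ S - e <= dot z z &
    dot (\sum_(z <- s) z) (\sum_(z <- s) z) <= N%:R * (S + 2 * e)].
Proof.
move=> S0 e0 ZS step; pose T := S + 2 * e.
have T0 : 0 <= T by rewrite /T; lra.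
suff: forall k, (k <= N)%N ->
    exists s : seq 'rV[R]_n, [/\ size s = k, forall z, z \in s -> Z z /\ S - e <= dot z z &
      dot (\sum_(z <- s) z) (\sum_(z <- s) z) <= k%:R * T] by apply.
elim=> [_|k IHk kN].
  exists [::]; split=> //; rewrite big_nil mul0r.
  by rewrite /dot big1 // => i _; rewrite mxE mul0r.
have [s [sk sZ sT]] := IHk (ltnW kN).
have [|z Zz [z1 z2]] := step (\sum_(z <- s) z).
  by apply: le_trans sT _; rewrite ler_wpM2r // ler_nat ltnW.
exists (z :: s); split=> [|y|]; first by rewrite /= sk.
  by rewrite inE => /orP[/eqP ->|/sZ].
rewrite big_cons !dotE (dotC _ z); have := ZS z Zz.
by rewrite -natr1 mulrDl mul1r {2}/T; lra.
Qed.

(** * The trace inequality for Gram matrices *)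

Lemma gram_sqr_sum (R : realFieldType) n (s : seq 'rV[R]_n) :
  \sum_(x <- s) \sum_(y <- s) dot x y ^+ 2 =
  \sum_(i < n) \sum_(j < n) (\sum_(x <- s) x ord0 i * x ord0 j) ^+ 2.
Proof.
transitivity (\sum_(x <- s) \sum_(y <- s) \sum_(i < n) \sum_(j < n)
    (x ord0 i * x ord0 j) * (y ord0 i * y ord0 j)).
  apply: eq_bigr => x _; apply: eq_bigr => y _.
  rewrite expr2 /dot mulr_suml; apply: eq_bigr => i _.
  by rewrite mulr_sumr; apply: eq_bigr => j _; ring.
under eq_bigr => x _ do rewrite exchange_big /=.
rewrite exchange_big /=; apply: eq_bigr => i _.
under eq_bigr => x _ do rewrite exchange_big /=.
rewrite exchange_big /=; apply: eq_bigr => j _.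
rewrite expr2 mulr_suml; apply: eq_bigr => x _.
by rewrite mulr_sumr.
Qed.

(* The right-hand sum is the squared Frobenius norm of [\sum_x x^T x], whose trace is
   [\sum_x dot x x]. *)
Lemma trace_gram (R : realFieldType) n (s : seq 'rV[R]_n) :
  (\sum_(x <- s) dot x x) ^+ 2 <= n%:R * \sum_(x <- s) \sum_(y <- s) dot x y ^+ 2.
Proof.
rewrite gram_sqr_sum exchange_big /=.
set t := fun i : 'I_n => \sum_(x <- s) x ord0 i * x ord0 i.
apply: (@le_trans _ _ (n%:R * \sum_i t i ^+ 2)); last first.
  rewrite ler_wpM2l ?ler0n //; apply: ler_sum => i _.
  by rewrite (bigD1 i) //= lerDl; apply: sumr_ge0 => j _; exact: sqr_ge0.
rewrite -/(\sum_i t i).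
have e1 : \sum_(i < n) \sum_(j < n) t i ^+ 2 = n%:R * \sum_i t i ^+ 2.
  by rewrite mulr_sumr; apply: eq_bigr => i _; rewrite sumr_const card_ord mulr_natl.
have e2 : \sum_(i < n) \sum_(j < n) t j ^+ 2 = n%:R * \sum_i t i ^+ 2.
  by rewrite sumr_const card_ord mulr_natl.
have : \sum_(i < n) \sum_(j < n) 2 * (t i * t j) <=
       \sum_(i < n) \sum_(j < n) (t i ^+ 2 + t j ^+ 2).
  apply: ler_sum => i _; apply: ler_sum => j _.
  by have := sqr_ge0 (t i - t j); lra.
under [X in _ <= X]eq_bigr do rewrite big_split.
rewrite big_split /= e1 e2.
under eq_bigr do rewrite -mulr_sumr -mulr_sumr.
by rewrite -mulr_sumr -mulr_suml -expr2; lra.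
Qed.

Lemma ler_sum_mem (R : numDomainType) (T : eqType) (s : seq T) (F G : T -> R) :
  (forall x, x \in s -> F x <= G x) -> \sum_(x <- s) F x <= \sum_(x <- s) G x.
Proof. by move=> FG; rewrite !big_seq; apply: ler_sum => x; exact: FG. Qed.

(* Sum [(dot x y + b) * (S - dot x y) >= 0] over all pairs. *)
Lemma obtuse_pair_bound (R : realFieldType) n (s : seq 'rV[R]_n) (S e b : R) :
  e <= S -> (forall x, x \in s -> S - e <= dot x x <= S) ->
  (forall x y, x \in s -> y \in s -> - b <= dot x y) ->
  ((size s)%:R * (S - e)) ^+ 2 <=
    n%:R * ((S - b) * dot (\sum_(x <- s) x) (\sum_(x <- s) x) + b * S * (size s)%:R ^+ 2).
Proof.
move=> eS sS sb; set N := (size s)%:R.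
have sN (c : R) : \sum_(x <- s) c = N * c.
  by rewrite big_const_seq count_predT iter_addr_0 mulr_natl.
have h1 : N * (S - e) <= \sum_(x <- s) dot x x.
  by rewrite -sN; apply: ler_sum_mem => x xs; case/andP: (sS x xs).
have h0 : 0 <= N * (S - e) by rewrite mulr_ge0 ?ler0n // subr_ge0.
apply: (@le_trans _ _ ((\sum_(x <- s) dot x x) ^+ 2)).
  by rewrite ler_pXn2r // nnegrE // (le_trans h0).
apply: le_trans (trace_gram s) _; rewrite ler_wpM2l ?ler0n //.
have dS : dot (\sum_(x <- s) x) (\sum_(x <- s) x) = \sum_(x <- s) \sum_(y <- s) dot x y.
  have dl z : dot (\sum_(x <- s) x) z = \sum_(x <- s) dot x z.
    elim: (s) => [|x r IH]; last by rewrite !big_cons dotDl IH.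
    by rewrite !big_nil /dot big1 // => i _; rewrite mxE mul0r.
  rewrite dl; apply: eq_bigr => x _.
  by rewrite dotC dl; apply: eq_bigr => y _; rewrite dotC.
have -> : (S - b) * dot (\sum_(x <- s) x) (\sum_(x <- s) x) + b * S * N ^+ 2 =
   \sum_(x <- s) \sum_(y <- s) ((S - b) * dot x y + b * S).
  rewrite dS mulr_sumr (_ : b * S * N ^+ 2 = \sum_(x <- s) \sum_(y <- s) b * S).
    rewrite -big_split /=; apply: eq_bigr => x _.
    by rewrite mulr_sumr -big_split.
  by rewrite !sN; ring.
apply: ler_sum_mem => x xs; apply: ler_sum_mem => y ys.
have : 0 <= (dot x y + b) * (S - dot x y).
  have := sS x xs; have := sS y ys; have := sb x y xs ys; have := ler_dot x y.
  by move=> ? ? /andP[? ?] /andP[? ?]; apply: mulr_ge0; lra.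
lra.
Qed.

(** Without such a pair, [obtuse_pair_bound] with [b = S/4 - e] would give
    [2*e*S+e^2 <= (3*S+4*e)*(S+2*e)/N], which fails for long sequences. *)
Lemma contact_pair (R : realType) (A : set 'rV[R]_4) (e : R) (x0 y0 : 'rV[R]_4) :
  A x0 -> A y0 -> 4/5 <= dot (x0-y0) (x0-y0) ->
  (forall x y, A x -> A y -> dot (x-y) (x-y) <= 1) -> 0 < e -> e <= 1/100 ->
  exists c S p d, [/\ forall x, A x -> dot (x-c) (x-c) <= S, A p /\ S - e <= dot (p-c) (p-c),
    A d /\ S - e <= dot (d-c) (d-c) & dot (p-c) (d-c) <= - (S/4) + e].
Proof.
move=> Ax0 Ay0 xy0 A1 e0 e1.
pose N := Num.bound (100/e).
(* With [S >= 1/5] this makes [2*N*e*S] exceed 40, against the bound 15 in [h4]. *)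
have Ne : 100 < N%:R * e.
  by rewrite -ltr_pdivrMr //; apply: archi_boundP; rewrite divr_ge0 // ltW.
have N0 : 0 < N%:R :> R by rewrite -(pmulr_lgt0 _ e0); apply: lt_trans Ne.
have [|||c [S [S2 AS step]]] := @nearly_minimal_center R 4 A e (N%:R * 4) _ A1 e0.
- by exists x0.
- by lra.
- by rewrite mulr_ge0 // ltW.
have S1 : 1/5 <= S.
  have := AS _ Ax0; have := AS _ Ay0; have := dot_ge0 ((x0 - c) + (y0 - c)).
  have : x0 - y0 = (x0 - c) - (y0 - c) by rewrite opprB addrA subrK.
  by move=> xyE; move: xy0; rewrite xyE !dotE; lra.
have [||||s [sN sZ sT]] := @balanced_sequence R 4 [set z | A (z + c)] S e N.
- by lra.
- by lra.
- by move=> z /AS; rewrite addrK.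
- move=> v vN; have [|a Aa [a1 a2]] := step v.
    by apply: le_trans vN _; rewrite ler_wpM2l //; lra.
  by exists (a - c) => //=; rewrite subrK.
have [[p [d [ps ds pd]]]|hno] := pselect (exists p d, [/\ p \in s, d \in s &
    dot p d <= - (S/4) + e]).
  have [/= Zp Sp] := sZ _ ps; have [/= Zd Sd] := sZ _ ds.
  by exists c, S, (p + c), (d + c); rewrite !addrK.
exfalso.
have eS : e <= S by lra.
have sS x : x \in s -> S - e <= dot x x <= S.
  by move=> /sZ[/= /AS]; rewrite addrK => -> ->.
have sb x y : x \in s -> y \in s -> - (S/4 - e) <= dot x y.
  move=> xs ys; rewrite leNgt; apply/negP => xy; apply: hno; exists x, y.
  by split => //; lra.
have := obtuse_pair_bound eS sS sb; rewrite sN.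
set D := dot _ _ in sT *; rewrite exprMn => bound.
have h1 : 0 <= (3/4*S+e) * (N%:R * (S + 2 * e) - D) by apply: mulr_ge0; lra.
have h2 : N%:R^+2 * (2*e*S+e^+2) <= N%:R * ((3*S+4*e)*(S+2*e)) by lra.
have h3 : N%:R * (2*e*S+e^+2) <= (3*S+4*e)*(S+2*e).
  by rewrite -(ler_pM2l N0) mulrA -expr2.
have h4 : (3*S+4*e)*(S+2*e) <= 15.
  have : (3*S+4*e)*(S+2*e) <= 7 * (15/7) by apply: ler_pM; lra.
  lra.
have h5 : 0 <= N%:R * e^+2 by rewrite mulr_ge0 ?sqr_ge0 ?ler0n.
have h6 : 0 <= (N%:R * e - 100) * S by apply: mulr_ge0; lra.
lra.
Qed.

(** * Reflections and a normal frame *)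

Definition householder (R : realFieldType) n (w x : 'rV[R]_n) : 'rV[R]_n :=
  x - (2 * dot x w / dot w w) *: w.

Lemma householderB (R : realFieldType) n (w x y : 'rV[R]_n) :
  householder w (x - y) = householder w x - householder w y.
Proof.
rewrite /householder !dotE mulrBr mulrBl; set s := _ / _; set t := _ / _.
by apply/rowP => i; rewrite !mxE; ring.
Qed.

Lemma dot_householder (R : realFieldType) n (w x : 'rV[R]_n) :
  dot (householder w x) (householder w x) = dot x x.
Proof.
rewrite /householder !dotE (dotC w x).
(* For [w = 0] the quotient is 0 by convention and the map is the identity. *)
have [w0|w0] := eqVneq (dot w w) 0; first by rewrite w0 invr0; ring.
by field.
Qed.

Lemma householder_eq (R : realFieldType) n (x y : 'rV[R]_n) :
  dot x x = dot y y -> householder (x - y) x = y.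
Proof.
move=> xy; rewrite /householder.
have -> : 2 * dot x (x - y) = dot (x - y) (x - y).
  by rewrite !dotE (dotC y x) -xy; ring.
have [w0|w0] := eqVneq (dot (x - y) (x - y)) 0.
  by rewrite (dot_eq0 w0) scaler0 subr0; exact/subr0_eq/dot_eq0.
by rewrite divff // scale1r opprB addrC subrK.
Qed.

Lemma householder_fix (R : realFieldType) n (w x : 'rV[R]_n) : dot x w = 0 -> householder w x = x.
Proof. by move=> xw; rewrite /householder xw mulr0 mul0r scale0r subr0. Qed.

Lemma diam_le (R : realType) n (A : set 'rV[R]_n) (r : R) : 0 <= r ->
  (forall x y, A x -> A y -> dot (x-y) (x-y) <= r^+2) -> (diam A <= r%:E)%E.
Proof.
move=> r0 Ar; rewrite /diam ge_max lee_fin r0 /=.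
apply: ge_ereal_sup => _ [x [y [Ax Ay ->]]]; rewrite lee_fin /enorm.
rewrite -[leRHS](ger0_norm r0) -sqrtr_sqr ler_wsqrtr //.
by have := Ar _ _ Ax Ay; rewrite /dot; under eq_bigr do rewrite -expr2.
Qed.

Lemma le_diam (R : realType) n (A : set 'rV[R]_n) (r : R) x y :
  (diam A <= r%:E)%E -> A x -> A y -> dot (x-y) (x-y) <= r^+2.
Proof.
move=> Ar Ax Ay.
have : ((enorm (x - y))%:E <= r%:E)%E.
  apply: le_trans Ar; rewrite /diam le_max; apply/orP; right.
  by apply: ereal_sup_ubound; exists x, y.
rewrite lee_fin => er.
have e0 : 0 <= enorm (x - y) by exact: sqrtr_ge0.
have -> : dot (x-y) (x-y) = enorm (x - y) ^+ 2.
  rewrite sqr_sqrtr; last by apply: sumr_ge0 => i _; exact: sqr_ge0.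
  by apply: eq_bigr => i _; rewrite expr2.
by rewrite ler_pXn2r // nnegrE // (le_trans e0).
Qed.

Lemma householderDZ (R : realFieldType) n (w x y : 'rV[R]_n) k :
  householder w (x + k *: y) = householder w x + k *: householder w y.
Proof.
rewrite /householder !dotE mulrDr mulrDl (mulrCA 2) -(mulrA k); set s := _ / _; set t := _ / _.
by apply/rowP => i; rewrite !mxE; ring.
Qed.

Definition coord (R : realFieldType) (x : 'rV[R]_4) (k : nat) : R := x ord0 (inord k).

Lemma coordB (R : realFieldType) (x y : 'rV[R]_4) k : coord (x - y) k = coord x k - coord y k.
Proof. by rewrite /coord !mxE. Qed.

Lemma dot4 (R : realFieldType) (x y : 'rV[R]_4) : dot x y =
  coord x 0 * coord y 0 + coord x 1 * coord y 1 + coord x 2 * coord y 2 + coord x 3 * coord y 3.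
Proof.
rewrite /dot (eq_bigr (fun i : 'I_4 => coord x i * coord y i)) => [|i _].
  by rewrite !big_ord_recr big_ord0 /= add0r.
by rewrite /coord inord_val.
Qed.

Definition vec (R : realFieldType) (s t : R) : 'rV[R]_4 :=
  \row_(i < 4) (if val i is k.+1 then if k is 0%N then t else 0 else s).

Lemma coord_vec (R : realFieldType) (s t : R) :
  (coord (vec s t) 0 = s) * (coord (vec s t) 1 = t) *
  (coord (vec s t) 2 = 0) * (coord (vec s t) 3 = 0).
Proof. by rewrite /coord !mxE /= !inordK. Qed.

(** One reflection turns [p - d] into the first axis. A second one fixes this axis and turns the
    vector from [c] to the midpoint of [p] and [d] into the first coordinate plane. A shift along
    the axis then brings the midpoint to first coordinate 0. *)
Lemma normal_frame (R : rcfType) (p d c : 'rV[R]_4) :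
  exists (T : 'rV[R]_4 -> 'rV[R]_4) a b g, [/\ 0 <= a, 0 <= b,
    forall x y, dot (T x - T y) (T x - T y) = dot (x - y) (x - y) &
    [/\ T p = vec a b, T d = vec (- a) b & T c = vec g 0]].
Proof.
pose l := Num.sqrt (dot (p - d) (p - d)).
have l0 : 0 <= l by exact: sqrtr_ge0.
have l2 : l ^+ 2 = dot (p - d) (p - d) by rewrite sqr_sqrtr ?dot_ge0.
pose H1 := householder ((p - d) - vec l 0).
have H1pd : H1 (p - d) = vec l 0.
  by apply: householder_eq; rewrite [RHS]dot4 !coord_vec -l2; ring.
pose m := (1/2) *: (p + d).
pose q := H1 (m - c).
pose b := Num.sqrt (coord q 1 ^+ 2 + coord q 2 ^+ 2 + coord q 3 ^+ 2).
have b2 : b ^+ 2 = coord q 1 ^+ 2 + coord q 2 ^+ 2 + coord q 3 ^+ 2.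
  by rewrite sqr_sqrtr // !addr_ge0 ?sqr_ge0.
pose v := vec (coord q 0) b.
pose H2 := householder (q - v).
have H2q : H2 q = v.
  by apply: householder_eq; rewrite !dot4 /v !coord_vec; move: b2; lra.
have H2l : H2 (vec l 0) = vec l 0.
  by apply: householder_fix; rewrite dot4 !(coordB q) /v !coord_vec; ring.
have lin1 x y k : H1 (x + k *: y) = H1 x + k *: H1 y by exact: householderDZ.
have lin2 x y k : H2 (x + k *: y) = H2 x + k *: H2 y by exact: householderDZ.
have iso1 x : dot (H1 x) (H1 x) = dot x x by exact: dot_householder.
have iso2 x : dot (H2 x) (H2 x) = dot x x by exact: dot_householder.
have H0 : H2 (H1 0) = 0 by apply: dot_eq0; rewrite iso2 iso1 /dot big1 // => i _; rewrite mxE mul0r.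
clearbody H1 H2.
have HH k : H2 (H1 (m - c + k *: (p - d))) = v + k *: vec l 0.
  by rewrite lin1 -/q H1pd lin2 H2q H2l.
pose T x := H2 (H1 (x - c)) - vec (coord q 0) 0.
exists T, (l/2), b, (- coord q 0); split; first by rewrite divr_ge0.
- exact: sqrtr_ge0.
- move=> x y.
  have -> : T x - T y = H2 (H1 (x - y)).
    have -> : x - y = (x - c) + (-1) *: (y - c) by rewrite scaleN1r opprB addrA subrK.
    by rewrite /T lin1 lin2 scaleN1r opprB addrA subrK.
  by rewrite iso2 iso1.
split.
- rewrite /T (_ : p - c = m - c + (1/2) *: (p - d)) ?HH; last first.
    by apply/rowP => i; rewrite !mxE; field.
  by apply/rowP => -[[|[|[|[|]]]]] // hi; rewrite !mxE /=; field.
- rewrite /T (_ : d - c = m - c + (-(1/2)) *: (p - d)) ?HH; last first.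
    by apply/rowP => i; rewrite !mxE; field.
  by apply/rowP => -[[|[|[|[|]]]]] // hi; rewrite !mxE /=; field.
rewrite /T subrr H0.
by apply/rowP => -[[|[|[|[|]]]]] // hi; rewrite !mxE /=; ring.
Qed.

(** The squared distances of the touching points from the centre (g, 0, 0) differ by 4a|g|, which is
    thus at most [e], so the origin can replace the centre at a cost below [5*e = 1/40/10^+2]. The
    inner product bound gives [a^2 >= 5/8*(a^2+b^2)] up to errors, and 78/125 leaves room for
    them. *)
Lemma frame_bounds (R : realFieldType) (a b g S e : R) : 0 <= a -> 0 <= b ->
  e = 1/20/10^+3 -> 1/4 - 1/40/10^+2 <= S -> 4*a^+2 <= 1 ->
  S - e <= (a-g)^+2+b^+2 -> (a-g)^+2+b^+2 <= S ->
  S - e <= (-a-g)^+2+b^+2 -> (-a-g)^+2+b^+2 <= S ->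
  g^+2 - a^+2 + b^+2 <= - (S/4) + e ->
  [/\ 0 < a, a <= 1/2, 78/125*(a^+2+b^+2) <= a^+2, 1/4 - 1/20/10^+2 <= a^+2+b^+2 &
   forall f m w, 0 <= w -> (f-g)^+2+m^+2+w <= S ->
     (f-a)^+2+(m-b)^+2+w <= 1 -> (f+a)^+2+(m-b)^+2+w <= 1 -> in_body a b f m w].
Proof.
move=> a0 b0 eE S1 a1 p1 p2 d1 d2 pd.
have g2 : 0 <= g^+2 := sqr_ge0 g.
have a39 : 39/100 <= a by apply: sqr_le => //; lra.
have ga : 4*a*`|g| <= e.
  have [g0|g0] := leP 0 g; [rewrite ger0_norm //|rewrite ltr0_norm //]; lra.
have g39 : 39/100 * `|g| <= a * `|g| by rewrite ler_wpM2r.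
have e0 : 0 <= e by rewrite eE !divr_ge0.
have g3 : `|g| <= 2/3*e by move: ga g39; rewrite -mulrA; move: (a * _) => y; lra.
have g4 : g^+2 <= e/100.
  rewrite -real_normK ?num_real //.
  have : 0 <= (2/3*e - `|g|)*`|g| by rewrite mulr_ge0 // subr_ge0.
  have : 0 <= (3/200 - `|g|)*e by apply: mulr_ge0; lra.
  move: (`|g|) => y; clear; lra.
split.
- lra.
- by apply: sqr_le; lra.
- lra.
- lra.
move=> f m w w0 hS h1 h2.
have P : f^+2+m^+2+w+2*a*`|f| - 2*b * m <= 1 - (a^+2+b^+2).
  have [f0|f0] := leP 0 f; [rewrite ger0_norm //|rewrite ltr0_norm //]; lra.
split=> //.
have f1 : `|f| <= 1.
  apply: sqr_le => //; rewrite expr1n real_normK ?num_real //.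
  have h3 := sqr_ge0 (m-b).
  have h4 : 0 <= a * `|f| by rewrite mulr_ge0.
  have h5 := sqr_ge0 a.
  lra.
have fg : f*g <= 2/3*e.
  apply: le_trans (ler_norm _) _; rewrite normrM.
  have : 0 <= (1 - `|f|) * `|g| by rewrite mulr_ge0 // subr_ge0.
  lra.
lra.
Qed.

(** * The partition *)

Theorem theorem2 (R : realType) (A : set 'rV[R]_4) (hA : diam A = 1%:E) :
  exists P : 'I_8 -> set 'rV[R]_4,
    weak_partition P A /\
    forall i : 'I_8, (diam (P i) < (9999%:R / 10000%:R : R)%:E)%E.
Proof.
have A1 x y : A x -> A y -> dot (x - y) (x - y) <= 1.
  by move=> Ax Ay; rewrite -[leRHS](expr1n _ 2); apply: (le_diam _ Ax Ay); rewrite hA.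
(* The diameter need not be attained, so a nearly extremal pair is taken. *)
have [x0 [y0 [Ax0 Ay0 xy0]]] : exists x y, [/\ A x, A y &
    (1 - 1/40/10^+2) ^+ 2 <= dot (x - y) (x - y)].
  apply: contrapT => hno.
  suff : (diam A <= (1 - 1/40/10^+2)%:E)%E by rewrite hA lee_fin; lra.
  apply: diam_le => [|x y Ax Ay]; first by lra.
  by rewrite leNgt; apply/negP => /ltW xy; apply: hno; exists x, y.
pose e : R := 1/20/10^+3.
have e0 : 0 < e by rewrite /e; lra.
have [||c [S [p [d [AS [Ap Sp] [Ad Sd] pd]]]]] := contact_pair Ax0 Ay0 _ A1 e0.
- by apply: le_trans xy0; lra.
- by rewrite /e; lra.
(* By the parallelogram law the squared distance from [x0] to [y0] is at most [4*S]. *)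
have S1 : 1/4 - 1/40/10^+2 <= S.
  have := AS _ Ax0; have := AS _ Ay0; have := dot_ge0 ((x0 - c) + (y0 - c)).
  have xyE : x0 - y0 = (x0 - c) - (y0 - c) by rewrite opprB addrA subrK.
  by move: xy0; rewrite xyE !dotE; lra.
have [T [a [b [g [a0 b0 iso [Tp Td Tc]]]]]] := normal_frame p d c.
have nvec x s t : T x = vec s t -> forall y, dot (y - x) (y - x) =
    (coord (T y) 0 - s)^+2 + (coord (T y) 1 - t)^+2
    + (coord (T y) 2 ^+ 2 + coord (T y) 3 ^+ 2).
  by move=> Tx y; rewrite -iso dot4 !coordB Tx !coord_vec; ring.
have pcE : dot (p - c) (p - c) = (a - g)^+2 + b^+2.
  by rewrite (nvec _ _ _ Tc) Tp !coord_vec; ring.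
have dcE : dot (d - c) (d - c) = (- a - g)^+2 + b^+2.
  by rewrite (nvec _ _ _ Tc) Td !coord_vec; ring.
have pdE : dot (p - d) (p - d) = 4 * a^+2.
  by rewrite (nvec _ _ _ Td) Tp !coord_vec; ring.
have pcdE : dot (p - c) (d - c) = g^+2 - a^+2 + b^+2.
  have pdE' : p - d = (p - c) - (d - c) by rewrite opprB addrA subrK.
  move: pcE dcE pdE; rewrite pdE'; move: (p - c) (d - c) => x y.
  by rewrite !dotE (dotC y x); lra.
have := A1 _ _ Ap Ad; rewrite pdE => a1.
have [|||||ap a2 aR R1 body] := frame_bounds a0 b0 (erefl e) S1 a1 (g := g).
- by rewrite -pcE.
- by rewrite -pcE; exact: AS.
- by rewrite -dcE.
- by rewrite -dcE; exact: AS.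
- by rewrite -pcdE.
pose h := Num.sqrt (41/25 * (a^+2+b^+2-(1/4-1/10^+3))).
pose G := Num.sqrt (3/4 + 1/10^+3 - a^+2).
have adm : admissible a b h G.
  have a3 : a^+2 <= 1/4 by lra.
  split=> //; split; rewrite ?sqrtr_ge0 // sqr_sqrtr //; lra.
pose q x := part b h G (coord (T x) 0) (coord (T x) 1) (coord (T x) 2) (coord (T x) 3).
have Abody x : A x ->
    in_body a b (coord (T x) 0) (coord (T x) 1) (coord (T x) 2 ^+ 2 + coord (T x) 3 ^+ 2).
  move=> Ax; apply: body; first by rewrite addr_ge0 ?sqr_ge0.
  - by have := AS _ Ax; rewrite (nvec _ _ _ Tc) subr0.
  - by have := A1 _ _ Ax Ap; rewrite (nvec _ _ _ Tp).
  - by have := A1 _ _ Ax Ad; rewrite (nvec _ _ _ Td) opprK.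
exists (fun i => [set x | A x /\ q x = i]); split.
  split; first by move=> i j _ _ [x [[_ qi] [_ qj]]]; apply: val_inj; rewrite /= -qi -qj.
  apply/seteqP; split=> [x [i _ [Ax _]] //|x Ax].
  by exists (Ordinal (part_lt8 b h G (coord (T x) 0) (coord (T x) 1) (coord (T x) 2) (coord (T x) 3))).
(* [(1 - 1/10^+3)^2] exceeds the bound [1 - 1/500] on squared distances. *)
move=> i; apply: (@le_lt_trans _ _ (1 - 1/10^+3)%:E).
  apply: diam_le => [|x y [Ax qx] [Ay qy]]; first by lra.
  apply: (@le_trans _ _ (1 - 1/500)); last by lra.
  have := part_pair adm (Abody _ Ax) (Abody _ Ay) (etrans qx (esym qy)).
  by rewrite -iso dot4 !coordB -!expr2.
by rewrite lte_fin; lra.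
Qed.
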